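(* There exists a complete Riemannian metric $g$ on $\mathbb R^2$ such that the linear operator $A\colon\mathbb R^2\to\mathbb R^2$, $A(s,u)=\left(\frac{s}{2},2u\right)$, is Anosov with respect to $g$ but does not have the shadowing property with respect to the Riemannian distance $d_g$ of $g$.
   Context: **Anosov.** A $C^1$ diffeomorphism $f\colon M\to M$ of a connected manifold is Anosov with respect to a Riemannian metric (with induced norm $\|\cdot\|$) if there exist a continuous $Df$-invariant splitting $TM=E^s\oplus E^u$ and constants $C>0$, $\lambda\in(0,1)$ such that $$\|Df_x^n|_{E_x^s}\|\leq C\lambda^n,\qquad \|Df_x^{-n}|_{E_x^u}\|\leq C\lambda^n$$ for every $x\in M$ and every integer $n\geq 0$. **Shadowing property.** Let $(Y,\rho)$ be a metric space and $g\colon Y\to Y$ a homeomorphism. A bi-infinite sequence $(x_n)_{n\in\mathbb Z}$ in $Y$ is a $\delta$-pseudo-orbit of $g$ if $\rho(g(x_n),x_{n+1})\leq\delta$ for every $n\in\mathbb Z$. The map $g$ has the shadowing property (is shadowable) if for every $\varepsilon>0$ there is $\delta>0$ such that for every $\delta$-pseudo-orbit $(x_n)_{n\in\mathbb Z}$ there is $x\in Y$ with $\rho(g^n(x),x_n)\leq\varepsilon$ for all $n\in\mathbb Z$. *)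

(* Defs.v *)
From HB Require Import structures.
From mathcomp Require Import all_boot all_order all_algebra.
From mathcomp Require Import all_classical all_reals all_analysis.

Set Implicit Arguments.
Unset Strict Implicit.
Unset Printing Implicit Defensive.

Import Order.TTheory GRing.Theory Num.Theory.
Import numFieldNormedType.Exports.

Local Open Scope classical_set_scope.
Local Open Scope ring_scope.

(* C^k maps between finite-dimensional spaces, through the derivatives along
   constant directions; differentiability is total (Frechet). *)
Fixpoint Ck (R : realType) (V W : normedModType R) (k : nat) (f : V -> W)
    {struct k} : Prop :=
  if k is k'.+1 then
    (forall x, differentiable f x) /\ (forall v, Ck k' (fun x => 'D_v f x))
  else continuous f.

Definition smooth (R : realType) (V W : normedModType R) (f : V -> W) : Prop :=
  forall k, Ck k f.

(* The inverse of a bijection is taken by choice; [bij_inv f] is only meaningful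
   when [f] is bijective. *)
Definition bij_inv (T : pointedType) (f : T -> T) : T -> T := pinv [set: T] f.

Definition iterz (T : pointedType) (f : T -> T) (n : int) : T -> T :=
  match n with
  | Posz k => iter k f
  | Negz k => iter k.+1 (bij_inv f)
  end.

Section ShadowingAndCompleteness.
Context (R : realType) (T : pointedType) (d : T -> T -> R).

Definition pseudo_orbit (f : T -> T) (delta : R) (x : int -> T) : Prop :=
  forall n : int, d (f (x n)) (x (n + 1)) <= delta.

Definition shadowing (f : T -> T) : Prop :=
  forall eps : R, 0 < eps ->
  exists2 delta : R, 0 < delta &
    forall x : int -> T, pseudo_orbit f delta x ->
    exists y : T, forall n : int, d (iterz f n y) (x n) <= eps.

Definition complete_dist : Prop :=
  forall u : nat -> T,
    (forall eps : R, 0 < eps -> exists N : nat, forall m n : nat,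
       (N <= m)%N -> (N <= n)%N -> d (u m) (u n) < eps) ->
    exists x : T, forall eps : R, 0 < eps -> exists N : nat, forall n : nat,
       (N <= n)%N -> d (u n) x < eps.

End ShadowingAndCompleteness.

Section Riemannian.
Context (R : realType) (n : nat).
Local Notation V := 'rV[R]_n.

(* [g x] is the Gram matrix of the inner product on T_x R^n = R^n. *)
Definition inner (g : V -> 'M[R]_n) (x v w : V) : R :=
  (v *m g x *m w^T) 0 0.

Definition riemannian_metric (g : V -> 'M[R]_n) : Prop :=
  [/\ forall i j, smooth (fun x => g x i j : R),
      forall x v w, inner g x v w = inner g x w v &
      forall x v, v != 0 -> 0 < inner g x v v].

Definition rnorm (g : V -> 'M[R]_n) (x v : V) : R := Num.sqrt (inner g x v v).

(* On a closed interval, C^1 up to the endpoints means that the map is the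
   restriction of a C^1 map defined on the whole line. *)
Definition C1_on_itv (a b : R) (c : R -> V) : Prop :=
  exists2 e : R -> V, Ck 1 e & forall t, a <= t <= b -> c t = e t.

(* [0 :: s] lists the breakpoints; continuity at these follows from the
   agreement on closed pieces. *)
Definition piecewise_C1 (c : R -> V) : Prop :=
  exists s : seq R,
    [/\ path <%R 0 s, last 0 s = 1 &
        forall i, (i < size s)%N ->
          C1_on_itv (nth 0 (0 :: s) i) (nth 0 s i) c].

(* The values of [derive1 c] at the finitely many points where [c] is not
   differentiable do not affect the integral. *)
Definition curve_length (g : V -> 'M[R]_n) (c : R -> V) : R :=
  Rintegral (@lebesgue_measure R) `[0, 1]
    (fun t : R => rnorm g (c t) (derive1 c t)).

Definition riemannian_dist (g : V -> 'M[R]_n) (x y : V) : R :=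
  inf [set l | exists c : R -> V,
    [/\ piecewise_C1 c, c 0 = x, c 1 = y & l = curve_length g c]].

Definition C1_diffeomorphism (f : V -> V) : Prop :=
  [/\ bijective f, Ck 1 f & Ck 1 (bij_inv f)].

(* Continuous subbundles of T R^n are the families of subspaces admitting
   continuous local frames. *)
Definition continuous_subbundle (E : V -> {vspace V}) : Prop :=
  forall x : V, exists (k : nat) (X : 'I_k -> V -> V),
    \forall y \near x,
      basis_of (E y) [seq X i y | i <- enum 'I_k] /\
      forall i, {for y, continuous (X i)}.

Definition splitting (Es Eu : V -> {vspace V}) : Prop :=
  forall x, (Es x + Eu x = fullv)%VS /\ (Es x :&: Eu x = 0)%VS.

Definition invariant_subbundle (f : V -> V) (E : V -> {vspace V}) : Prop :=
  forall x, (linfun ('d f x) @: E x)%VS = E (f x).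

(* Operator norm of [L] restricted to [E], as a map from (T_x, g_x) to
   (T_y, g_y). *)
Definition restr_norm (g : V -> 'M[R]_n) (x y : V) (E : {vspace V})
    (L : V -> V) : \bar R :=
  ereal_sup [set (rnorm g y (L v))%:E | v in
             [set v : V | v \in E /\ rnorm g x v <= 1]].

Definition anosov (g : V -> 'M[R]_n) (f : V -> V) : Prop :=
  C1_diffeomorphism f /\
  exists (Es Eu : V -> {vspace V}) (C lambda : R),
    [/\ [/\ continuous_subbundle Es, continuous_subbundle Eu &
            splitting Es Eu],
        invariant_subbundle f Es /\ invariant_subbundle f Eu,
        0 < C /\ 0 < lambda < 1,
        forall (x : V) (k : nat),
          (restr_norm g x (iter k f x) (Es x) ('d (iter k f) x)
             <= (C * lambda ^+ k)%:E)%E &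
        forall (x : V) (k : nat),
          (restr_norm g x (iter k (bij_inv f) x) (Eu x)
             ('d (iter k (bij_inv f)) x)
             <= (C * lambda ^+ k)%:E)%E].

End Riemannian.

Definition point2 (R : realType) (s u : R) : 'rV[R]_2 :=
  \row_j (if j == 0 then s else u).

Definition opA (R : realType) (p : 'rV[R]_2) : 'rV[R]_2 :=
  point2 (p 0 0 / 2) (2 * p 0 1).

(* Main.v *)
From HB Require Import structures.
Require Import Defs.
From mathcomp Require Import all_boot all_order all_algebra.
From mathcomp Require Import all_classical all_reals all_analysis.
From mathcomp Require Import ring lra measurable_realfun.
Import Order.TTheory GRing.Theory Num.Theory.
Import numFieldNormedType.Exports.
Local Open Scope classical_set_scope.
Local Open Scope ring_scope.
Set Implicit Arguments.
Unset Strict Implicit.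
Unset Printing Implicit Defensive.

(** Put [c = s + u], [w = s - u] and take the warped product metric
    [g = dc^2 + exp (- c^2) dw^2].

    Both coordinate vectors satisfy [|dw| = |dc|], so at every point their
    [g]-norm lies between [1] and [sqrt 2] (the warping factor is at most [1]).
    Along the constant splitting into coordinate axes, [g] is therefore
    uniformly comparable with the Euclidean metric, and [A] is Anosov with
    [C = 2] and [lambda = 1/2] (lemma [anosov_opA]).  The Anosov condition does
    not see the angle between the two bundles, and for this metric that angle
    tends to [0] as [|c|] tends to infinity.

    This collapse destroys shadowing.  The points [q = (2t, t)] and
    [A q = (t, 2t)] have the same [c = 3t], and the segment between them has
    length [2t exp (- 9t^2/2)], which tends to [0] as [t] grows.  Hence, for
    each [delta], the constant sequence [q] is a [delta]-pseudo-orbit once [t] is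
    large.  On the other hand [|c x - c y| <= d x y] (lemma [csum_le_dist]), so
    an orbit that [1]-shadows the constant sequence has bounded [c]; the only
    such orbit of the hyperbolic map [A] is the fixed point [0] (lemma
    [bounded_orbit0]), whose distance to [q] is at least [3t > 1].

    The metric is complete (lemma [complete_gwarp]): along a Cauchy sequence [c]
    is Cauchy, hence bounded, and on a strip where [c] is bounded the warping
    factor is bounded below, so that [w] is Cauchy as well (lemma
    [cdiff_le_dist]).

    Both lower bounds for the distance come from [curve_bound]: if a linear form
    is dominated by [K] times the [g]-norm along a piecewise C^1 curve, then it
    varies by at most [K] times the length of that curve. *)

(** * Linear maps on row vectors and C^k maps *)

Section LinearMaps.
Context (R : realType).

Lemma linear_rV_continuous (n : nat) (W : normedModType R)
    (f : {linear 'rV[R]_n -> W}) : continuous f.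
Proof.
have -> : (f : 'rV[R]_n -> W) =
    fun v : 'rV[R]_n => \sum_(i < n) v 0 i *: f (delta_mx 0 i).
  apply/funext => v; rewrite {1}[v]row_sum_delta linear_sum.
  by apply: eq_bigr => i _; rewrite linearZ.
apply: continuous_big => [|i _]; first exact: add_continuous.
have ci : continuous (fun v : 'rV[R]_n => v 0 i) by exact: coord_continuous.
by move=> v; apply: continuousZr_tmp; exact: ci.
Qed.

Lemma derive1_linear_comp (W : normedModType R) (n : nat)
    (l : {linear 'rV[R]_n -> W}) (e : R -> 'rV[R]_n) t : differentiable e t ->
  derivable (fun t => l (e t)) t 1 /\
  (fun t => l (e t))^`()%classic t = l (e^`()%classic t).
Proof.
move=> de.
have dl : differentiable (l : 'rV[R]_n -> W) (e t).
  exact/linear_differentiable/linear_rV_continuous.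
have dle : differentiable (fun t => l (e t)) t.
  exact: (@differentiable_comp _ _ _ _ e (l : _ -> _)).
split; first exact: diff_derivable.
rewrite !derive1E !deriveE//.
rewrite (@diff_comp _ _ _ _ e (l : _ -> _) _ de dl)/=.
by rewrite diff_lin//; exact: linear_rV_continuous.
Qed.

Lemma iter_is_linear (n : nat) (f : {linear 'rV[R]_n -> 'rV[R]_n}) k :
  exists h : {linear 'rV[R]_n -> 'rV[R]_n},
    h = iter k f :> ('rV[R]_n -> 'rV[R]_n).
Proof.
elim: k => [|k [h IH]]; first by exists idfun.
by exists (f \o h); apply/funext => x /=; rewrite IH.
Qed.

Lemma diff_iter (n : nat) (f : {linear 'rV[R]_n -> 'rV[R]_n}) k
    (x : 'rV[R]_n) :
  'd (iter k f) x = iter k f :> ('rV[R]_n -> 'rV[R]_n).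
Proof.
have [h <-] := iter_is_linear f k.
by apply: diff_lin; exact: linear_rV_continuous.
Qed.

Lemma Ck_add (k : nat) (U W : normedModType R) (f h : U -> W) :
  Ck k f -> Ck k h -> Ck k (fun x => f x + h x).
Proof.
elim: k f h => [|k IH] f h /=.
  by move=> cf ch x; apply: cvgD; [exact: cf|exact: ch].
move=> [df kf] [dh kh]; split=> [x|v]; first exact: differentiableD.
have -> : (fun x => 'D_v (fun x => f x + h x) x) =
    (fun x => 'D_v f x + 'D_v h x).
  by apply/funext => x; rewrite deriveD//; exact: diff_derivable.
by apply: IH; [exact: kf|exact: kh].
Qed.

Lemma Ck_cst (k : nat) (U W : normedModType R) (a : W) :
  Ck k (fun _ : U => a).
Proof.
elim: k a => [|k IH] a /=; first by move=> x; exact: cvg_cst.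
split=> [x|v]; first exact: differentiable_cst.
have -> : (fun x => 'D_v (fun _ : U => a) x) = (fun _ => 0).
  by apply/funext => x; exact: derive_cst.
exact: IH.
Qed.

Lemma Ck_linear (k : nat) (U W : normedModType R) (f : {linear U -> W}) :
  continuous f -> Ck k f.
Proof.
move=> cf; case: k => [//|k] /=; split=> [x|v].
  exact: linear_differentiable.
have -> : (fun x => 'D_v f x) = (fun _ => f v).
  apply/funext => x; rewrite deriveE; last exact: linear_differentiable.
  by rewrite diff_lin.
exact: Ck_cst.
Qed.

End LinearMaps.

(** * Integrals of functions that are continuous between breakpoints *)

Section PiecewiseIntegrals.
Context (R : realType).
Local Notation mu := (@lebesgue_measure R).
Implicit Types (a b t K : R) (F h e H : R -> R).

Lemma integrable_continuous_itv a b H : continuous H ->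
  mu.-integrable `[a, b] (EFin \o H).
Proof.
move=> cH; apply: continuous_compact_integrable; first exact: segment_compact.
exact: continuous_subspaceT.
Qed.

Lemma integrable_oo_cc a b h : mu.-integrable `]a, b[ (EFin \o h) ->
  mu.-integrable `[a, b] (EFin \o h).
Proof.
move=> /integrableP[mh fh].
have mh' := @emeasurable_fun_itv_cc R a b false true _ mh.
apply/integrableP; split=> //.
rewrite integral_itv_bndoo//.
by apply: measurableT_comp.
Qed.

(** The speed of a piecewise C^1 curve agrees with a continuous function only
    inside each piece: at a breakpoint the derivative of the curve may fail to
    exist, and its value there is arbitrary. *)
Lemma eq_oo_integrable a b h H : continuous H ->
  (forall t, a < t < b -> h t = H t) -> mu.-integrable `[a, b] (EFin \o h).
Proof.
move=> cH hH; apply: integrable_oo_cc.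
have Hi : mu.-integrable `]a, b[ (EFin \o H).
  apply: integrableS (integrable_continuous_itv a b cH) => //.
  exact: subset_itv_oo_cc.
apply: eq_integrable Hi => //.
by move=> t; rewrite inE/= in_itv/= => /hH ->.
Qed.

Lemma eq_oo_Rintegral a b h H : continuous H ->
  (forall t, a < t < b -> h t = H t) ->
  \int[mu]_(t in `[a, b]) h t = \int[mu]_(t in `[a, b]) H t.
Proof.
move=> cH hH; rewrite /Rintegral; congr fine; apply: eq_integral_itv_bounded.
- apply/measurable_EFinP.
  by apply: measurable_funS (measurable_int _ (eq_oo_integrable cH hH)) => //;
    exact: subset_itv_oo_cc.
- apply/measurable_EFinP.
  by apply: measurable_funS (measurable_int _ (integrable_continuous_itv a b cH))
    => //; exact: subset_itv_oo_cc.
- by move=> t; rewrite in_itv/= => /hH.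
Qed.

Lemma integrable_concat a b (c : R) h : a <= b -> b <= c ->
  mu.-integrable `[a, b] (EFin \o h) -> mu.-integrable `[b, c] (EFin \o h) ->
  mu.-integrable `[a, c] (EFin \o h).
Proof.
move=> ab bc iab ibc.
have U : `[a, c]%classic = `[a, b] `|` `]b, c].
  by apply: itv_bndbnd_setU; rewrite bnd_simp.
have ibc' : mu.-integrable `]b, c] (EFin \o h).
  by apply: integrableS ibc => //; apply: subset_itvr; rewrite bnd_simp.
move: iab ibc' => /integrableP[mab fab] /integrableP[mbc fbc].
have mU := (measurable_funU _ (measurable_itv _) (measurable_itv _)).2
  (conj mab mbc).
rewrite U; apply/integrableP; split=> //; rewrite ge0_integral_setU//.
- exact: lte_add_pinfty.
- by apply: measurableT_comp.
- apply/disj_setPS => y [/=]; rewrite 2!in_itv/= => /andP[_ yx] /andP[].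
  by rewrite ltNge yx.
Qed.

Lemma Rintegral_concat a b (c : R) h : a <= b -> b <= c ->
  mu.-integrable `[a, c] (EFin \o h) ->
  \int[mu]_(t in `[a, c]) h t =
  \int[mu]_(t in `[a, b]) h t + \int[mu]_(t in `[b, c]) h t.
Proof.
move=> ab bc iac.
apply/eqP; rewrite addrC -subr_eq; apply/eqP.
rewrite Rintegral_itvB ?bnd_simp// Rintegral_itv_obnd_cbnd//.
by apply: integrableS iac => //; apply: subset_itvr; rewrite bnd_simp.
Qed.

(** The fundamental theorem of calculus for [e], the C^1 extension of [F]; the
    values of the speed [h] at the endpoints do not matter to the integral. *)
Lemma piece_bound a b K F h e H : a < b ->
    (forall t, derivable e t 1) -> continuous e^`()%classic -> continuous H ->
    (forall t, a <= t <= b -> F t = e t) ->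
    (forall t, a < t < b -> h t = H t) ->
    (forall t, a <= t <= b -> `|e^`()%classic t| <= K * H t) ->
  forall t, a <= t <= b ->
  `|F t - F a| <= K * \int[mu]_(t in `[a, t]) h t.
Proof.
move=> ab de ce cH Fe hH eH t /andP[].
rewrite le_eqVlt => /predU1P[<-|] tb.
  by rewrite subrr normr0 set_itv1 Rintegral_set1 mulr0.
move=> tb'.
have -> : F t = e t by rewrite Fe// (ltW tb).
have -> : F a = e a by rewrite Fe// lexx ltW.
rewrite (@eq_oo_Rintegral _ _ _ H) //; last first.
  by move=> x /andP[ax xt]; rewrite hH// ax (lt_le_trans xt).
have -> : e t - e a = \int[mu]_(x in `[a, t]) (e^`()%classic x).
  rewrite /Rintegral (@continuous_FTC2 _ _ e) //.
    exact: continuous_subspaceT.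
  have ec : continuous e.
    by move=> x; apply: differentiable_continuous; exact/derivable1_diffP.
  split; first by move=> *; exact: de.
    by apply: cvg_at_right_filter; exact: ec.
  by apply: cvg_at_left_filter; exact: ec.
have Hi := integrable_continuous_itv a t cH.
apply: (le_trans (le_normr_Rintegral _ _)) => //.
  exact: integrable_continuous_itv.
rewrite -RintegralZl//; apply: le_Rintegral => //.
- have /integrable_norm := integrable_continuous_itv a t ce.
  exact.
- apply: (@integrable_continuous_itv a t (fun x => K * H x)) => x.
  by apply: cvgM; [exact: cvg_cst|exact: cH].
- move=> x /=; rewrite in_itv/= => /andP[ax xt].
  by rewrite eH// ax (le_trans xt).
Qed.

End PiecewiseIntegrals.

(** * Piecewise C^1 curves and Riemannian distance *)

Section Curves.
Context (R : realType) (n : nat) (g : 'rV[R]_n -> 'M[R]_n).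
Context (cg : forall i j, continuous (fun x => g x i j : R)).
Local Notation V := 'rV[R]_n.
Local Notation mu := (@lebesgue_measure R).

Lemma rnorm_continuous (x v : R -> V) : continuous x -> continuous v ->
  continuous (fun t => rnorm g (x t) (v t)).
Proof.
move=> cx cv.
have cvi i : continuous (fun t => v t 0 i).
  have ci : continuous (fun y : V => y 0 i) by exact: coord_continuous.
  by move=> t; exact: (continuous_comp (cv t) (ci _)).
have cgx i j : continuous (fun t => g (x t) i j).
  move=> t; apply: (@continuous_comp _ _ _ x (fun y => g y i j)).
    exact: cx.
  exact: cg.
have cF : continuous (fun t => inner g (x t) (v t) (v t)).
  have -> : (fun t => inner g (x t) (v t) (v t)) = fun t =>
      \sum_j (\sum_i v t 0 i * g (x t) i j) * v t 0 j.
    apply/funext => t; rewrite /inner mxE; apply: eq_bigr => j _.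
    by rewrite !mxE.
  apply: continuous_big => [|j _]; first exact: add_continuous.
  have cS : continuous (fun t => \sum_i v t 0 i * g (x t) i j).
    apply: continuous_big => [|i _]; first exact: add_continuous.
    by move=> t; apply: cvgM; [exact: cvi|exact: cgx].
  by move=> t; apply: cvgM; [exact: cS|exact: cvi].
by move=> t; exact: (continuous_comp (cF t) (@sqrt_continuous R _)).
Qed.

Definition speed (c : R -> V) (t : R) : R := rnorm g (c t) (c^`()%classic t).

(** On the open interval the curve and its C^1 extension agree near every point,
    hence have the same derivative. *)
Lemma C1_piece (c : R -> V) a b : a < b -> C1_on_itv a b c ->
  mu.-integrable `[a, b] (EFin \o speed c) /\
  forall (l : {linear V -> R}) K,
    (forall t v, a <= t <= b -> `|l v| <= K * rnorm g (c t) v) ->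
  forall t, a <= t <= b ->
  `|l (c t) - l (c a)| <= K * \int[mu]_(t in `[a, t]) speed c t.
Proof.
move=> ab [e [de ce'] ce].
have cee : continuous e.
  by move=> t; apply: differentiable_continuous.
have ce1 : continuous e^`()%classic.
  have <- : (fun t => 'D_1 e t) = e^`()%classic.
    by apply/funext => t; rewrite derive1E.
  exact: ce' 1.
have cH := rnorm_continuous cee ce1.
have sH t : a < t < b -> speed c t = rnorm g (e t) (e^`()%classic t).
  move=> /andP[at_ tb]; rewrite /speed ce ?(ltW at_) ?(ltW tb)//.
  congr rnorm; rewrite !derive1E; apply: near_eq_derive.
  have tin : t \in `]a, b[ by rewrite in_itv/= at_.
  near=> s.
  have /= : s \in `]a, b[ by near: s; exact: near_in_itvoo.
  by rewrite in_itv/= => /andP[as_ sb]; rewrite ce// (ltW as_) (ltW sb).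
split; first exact: eq_oo_integrable cH sH.
move=> l K lK.
have dl t := derive1_linear_comp l (de t).
apply: (@piece_bound _ a b K (fun t => l (c t)) (speed c) (fun t => l (e t))
  (fun t => rnorm g (e t) (e^`()%classic t))) => //.
- by move=> t; case: (dl t).
- have -> : (fun t => l (e t))^`()%classic = fun t => l (e^`()%classic t).
    by apply/funext => t; case: (dl t).
  move=> t; apply: (@continuous_comp _ _ _ _ (l : _ -> _)); first exact: ce1.
  exact: linear_rV_continuous.
- by move=> t tab; rewrite ce.
- by move=> t tab; have [_ ->] := dl t; rewrite -ce//; exact: lK.
Unshelve. all: by end_near. Qed.

(** The estimate is carried along the list of breakpoints together with the
    integrability of the speed: an integral that is not finite would be read as
    [0] in the definition of the length. *)
Lemma path_bound (c : R -> V) a s : path <%R a s ->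
  (forall i, (i < size s)%N ->
     C1_on_itv (nth 0 (a :: s) i) (nth 0 s i) c) ->
  mu.-integrable `[a, last a s] (EFin \o speed c) /\
  forall (l : {linear V -> R}) K,
    (forall t v, a <= t <= last a s -> `|l v| <= K * rnorm g (c t) v) ->
  forall t, a <= t <= last a s ->
  `|l (c t) - l (c a)| <= K * \int[mu]_(t in `[a, t]) speed c t.
Proof.
elim: s a => [|b s IH] a /=.
  (* an empty list of breakpoints leaves the degenerate interval [a, a] *)
  move=> _ _; split.
    apply: integrable_oo_cc; rewrite set_itv_ge ?bnd_simp ?ltxx//.
    exact: integrable_set0.
  move=> l K _ t; rewrite -eq_le => /eqP <-.
  by rewrite subrr normr0 set_itv1 Rintegral_set1 mulr0.
move=> /andP[ab bs] cs.
have [i1 b1] := C1_piece ab (cs 0%N isT).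
have [i2 b2] := IH b bs (fun i => cs i.+1).
have bl : b <= last b s.
  have := order_path_min lt_trans bs.
  case: (lastP s) => [//|s' x]; rewrite last_rcons all_rcons => /andP[/ltW]//.
have i12 := integrable_concat (ltW ab) bl i1 i2.
split=> // l K lK t /andP[at_ tl].
have [tb|bt] := leP t b.
  apply: b1; last by rewrite at_.
  by move=> t' v /andP[at' tb']; apply: lK; rewrite at' (le_trans tb').
rewrite (@Rintegral_concat _ a b t) ?(ltW ab) ?(ltW bt)//; last first.
  by apply: integrableS i12 => //; apply: subset_itvl; rewrite bnd_simp.
rewrite mulrDr [leRHS]addrC.
have -> : l (c t) - l (c a) = (l (c t) - l (c b)) + (l (c b) - l (c a)) by ring.
apply: (le_trans (ler_normD _ _)); apply: lerD.
  apply: b2; last by rewrite (ltW bt).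
  by move=> t' v /andP[at' tb']; apply: lK; rewrite tb' (le_trans (ltW ab)).
apply: b1; last by rewrite lexx ltW.
by move=> t' v /andP[at' tb']; apply: lK; rewrite at' (le_trans tb').
Qed.

(** A linear form dominated by [K] times the norm of the metric is [K]-Lipschitz
    along the curve.  The domination is only required on the curve itself, so
    that [K] may depend on a region that the curve is known to stay in. *)
Lemma curve_bound (c : R -> V) (l : {linear V -> R}) K : piecewise_C1 c ->
  0 <= K ->
  (forall t v, 0 <= t <= 1 -> `|l v| <= K * rnorm g (c t) v) ->
  forall t, 0 <= t <= 1 -> `|l (c t) - l (c 0)| <= K * curve_length g c.
Proof.
move=> [s [ps ls cs]] K0 lK t /andP[t0 t1].
have [i01 b01] := path_bound ps cs.
rewrite ls in i01 b01.
apply: (le_trans (b01 l K lK t _)); first by rewrite t0.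
apply: ler_wpM2l => //; rewrite /curve_length.
rewrite (@Rintegral_concat _ 0 t 1)// lerDl.
by apply: Rintegral_ge0 => x _; exact: sqrtr_ge0.
Qed.

(** Named so that, in the scalar, it can carry the structure of a linear map. *)
Definition scale_vec (w : V) (t : R) : V := t *: w.
Fact scale_vec_linear w : linear (scale_vec w : R^o -> V).
Proof. by move=> a x y; rewrite /scale_vec scalerDl scalerA. Qed.
HB.instance Definition _ w :=
  GRing.isLinear.Build R R^o V *:%R (scale_vec w) (scale_vec_linear w).

Definition segment (x y : V) (t : R) : V := x + scale_vec (y - x) t.

Lemma Ck_segment k x y : Ck k (segment x y).
Proof.
apply: Ck_add; first exact: Ck_cst.
apply: (@Ck_linear R k R^o V (scale_vec (y - x))).
by move=> t; apply: continuousZr_tmp; exact: cvg_id.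
Qed.

Lemma derive1_segment x y t : (segment x y)^`()%classic t = y - x.
Proof.
rewrite derive1E /segment.
have h : differentiable (scale_vec (y - x) : R^o -> V) t.
  apply: (@linear_differentiable _ R^o V (scale_vec (y - x))).
  by move=> s; apply: continuousZr_tmp; exact: cvg_id.
rewrite deriveD; [|exact: derivable_cst|exact: diff_derivable].
rewrite derive_cst add0r deriveE// diff_lin; first exact: scale1r.
by move=> s; apply: continuousZr_tmp; exact: cvg_id.
Qed.

Lemma piecewise_C1_segment x y : piecewise_C1 (segment x y).
Proof.
exists [:: 1]; split=> //=; first by rewrite ltr01.
by case=> // _; exists (segment x y) => //; exact: (Ck_segment 1).
Qed.

Lemma segment0 x y : segment x y 0 = x.
Proof. by rewrite /segment /scale_vec scale0r addr0. Qed.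

Lemma segment1 x y : segment x y 1 = y.
Proof. by rewrite /segment /scale_vec scale1r addrC subrK. Qed.

Lemma curve_length_ge0 (c : R -> V) : 0 <= curve_length g c.
Proof. by apply: Rintegral_ge0 => t _; exact: sqrtr_ge0. Qed.

Lemma curve_lengths_nonempty x y :
  [set l | exists c : R -> V,
    [/\ piecewise_C1 c, c 0 = x, c 1 = y & l = curve_length g c]] !=set0.
Proof.
exists (curve_length g (segment x y)), (segment x y); split=> //.
- exact: piecewise_C1_segment.
- exact: segment0.
- exact: segment1.
Qed.

Lemma dist_le_segment x y B :
  (forall t, 0 <= t <= 1 -> rnorm g (segment x y t) (y - x) <= B) ->
  riemannian_dist g x y <= B.
Proof.
move=> sB; apply: (@le_trans _ _ (curve_length g (segment x y))).
  apply: ge_inf; first by exists 0 => _ [c [_ _ _ ->]]; exact: curve_length_ge0.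
  exists (segment x y); split=> //; first exact: piecewise_C1_segment.
  - exact: segment0.
  - exact: segment1.
have -> : B = \int[mu]_(t in `[0, 1]) B.
  by rewrite Rintegral_cst//= lebesgue_measure_itv/= lte_fin ltr01 sube0 mulr1.
have [s [ps ls cs]] := piecewise_C1_segment x y.
have [i01 _] := path_bound ps cs.
rewrite ls in i01.
apply: le_Rintegral => //.
  by apply: integrable_continuous_itv => t; exact: cvg_cst.
move=> t /=; rewrite in_itv/= => t01.
by rewrite derive1_segment; exact: sB.
Qed.

End Curves.

(** * The warped metric *)

Section WarpedMetric.
Context (R : realType).
Local Notation V := 'rV[R]_2.
Implicit Types (x y v w : V) (a : R).

Lemma eq_rV2 x y : x 0 0 = y 0 0 -> x 0 1 = y 0 1 -> x = y.
Proof.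
move=> h0 h1; apply/rowP => -[[|[|//]] h].
  by have -> : Ordinal h = 0 by exact/val_inj.
by have -> : Ordinal h = 1 by exact/val_inj.
Qed.

Definition csum x : R := x 0 0 + x 0 1.
Definition cdiff x : R := x 0 0 - x 0 1.

Fact csum_linear : linear csum.
Proof. by move=> a x y; rewrite /csum !mxE /GRing.scale/=; ring. Qed.
Fact cdiff_linear : linear cdiff.
Proof. by move=> a x y; rewrite /cdiff !mxE /GRing.scale/=; ring. Qed.
HB.instance Definition _ :=
  GRing.isLinear.Build R V R *:%R csum csum_linear.
HB.instance Definition _ :=
  GRing.isLinear.Build R V R *:%R cdiff cdiff_linear.

Lemma csum_point2 (s u : R) : csum (point2 s u) = s + u.
Proof. by rewrite /csum !mxE. Qed.

Lemma cdiff_point2 (s u : R) : cdiff (point2 s u) = s - u.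
Proof. by rewrite /cdiff !mxE. Qed.

Lemma csumD x y : csum (x + y) = csum x + csum y. Proof. exact: linearD. Qed.
Lemma csumB x y : csum (x - y) = csum x - csum y. Proof. exact: linearB. Qed.
Lemma csumZ a x : csum (a *: x) = a * csum x. Proof. exact: linearZ. Qed.
Lemma cdiffB x y : cdiff (x - y) = cdiff x - cdiff y. Proof. exact: linearB. Qed.
Lemma cdiffZ a x : cdiff (a *: x) = a * cdiff x. Proof. exact: linearZ. Qed.

Definition warp x : R := expR (- (csum x) ^+ 2).

Lemma warp_gt0 x : 0 < warp x. Proof. exact: expR_gt0. Qed.

Lemma warp_ge0 x : 0 <= warp x. Proof. exact/ltW/warp_gt0. Qed.

(** The Gram matrix of [dc^2 + exp (- c^2) dw^2] in the coordinates [s, u]; see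
    [innerE]. *)
Definition gwarp x : 'M[R]_2 :=
  \matrix_(i, j) (if i == j then 1 + warp x else 1 - warp x).

Lemma innerE x v w :
  inner gwarp x v w = csum v * csum w + warp x * (cdiff v * cdiff w).
Proof.
rewrite /inner mxE big_ord_recl big_ord1 !mxE !big_ord_recl !big_ord0 !mxE/=.
rewrite /csum /cdiff.
have -> : lift ord0 ord0 = 1 :> 'I_2 by apply/val_inj.
by rewrite -/(0 : 'I_2); ring.
Qed.

(** Polynomials in [c] times [exp (- c^2)] form a class that contains the
    warping factor and is stable under directional derivatives; this gives
    smoothness. *)
Definition polygauss (p : {poly R}) x : R :=
  p.[csum x] * expR (- (csum x) ^+ 2).

Lemma is_derive_polygauss1 (p : {poly R}) (t : R) :
  is_derive t 1 (fun t : R => p.[t] * expR (- t ^+ 2))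
    ((p^`() - 2%:P * 'X * p).[t] * expR (- t ^+ 2)).
Proof.
have h : is_derive t (1 : R) (fun t : R => - t ^+ 2) (- (2 * t)).
  by apply: is_derive_eq; rewrite /GRing.scale/=; ring.
have h2 := @is_derive1_comp _ expR (fun t : R => - t ^+ 2) t _ _ _ h.
apply: is_derive_eq.
by rewrite !hornerE /GRing.scale/=; ring.
Qed.

Lemma differentiable_polygauss p x : differentiable (polygauss p) x.
Proof.
apply: (@differentiable_comp _ _ _ _ (csum : V -> R)
  (fun t : R => p.[t] * expR (- t ^+ 2))).
  exact/linear_differentiable/linear_rV_continuous.
by apply/derivable1_diffP; have [] := is_derive_polygauss1 p (csum x).
Qed.

Lemma derive_polygauss p x v :
  'D_v (polygauss p) x = polygauss ((csum v)%:P * (p^`() - 2%:P * 'X * p)) x.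
Proof.
have dc : differentiable (csum : V -> R) x.
  exact/linear_differentiable/linear_rV_continuous.
have db := is_derive_polygauss1 p (csum x).
have df : differentiable (fun t : R => p.[t] * expR (- t ^+ 2)) (csum x).
  by apply/derivable1_diffP; case: db.
rewrite deriveE; last exact: differentiable_polygauss.
rewrite (@diff_comp _ _ _ _ (csum : V -> R) _ _ dc df)/=.
rewrite diff_lin; last exact: linear_rV_continuous.
rewrite diff1E//= derive1E derive_val /polygauss /GRing.scale/= !hornerE.
exact: erefl.
Qed.

Lemma smooth_polygauss p : smooth (polygauss p).
Proof.
move=> k; elim: k p => [|k IH] p /=.
  by move=> x; apply: differentiable_continuous; exact: differentiable_polygauss.
split=> [x|v]; first exact: differentiable_polygauss.
rewrite (_ : (fun x => _) =
  polygauss ((csum v)%:P * (p^`() - 2%:P * 'X * p))) //.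
by apply/funext => x; exact: derive_polygauss.
Qed.

Lemma riemannian_metric_gwarp : riemannian_metric gwarp.
Proof.
split.
- move=> i j k.
  have [ij|ij] := eqVneq i j.
    rewrite (_ : (fun x => _) = (fun x => 1 + polygauss 1 x)).
      by apply: Ck_add; [exact: Ck_cst|exact: smooth_polygauss].
    by apply/funext => x; rewrite mxE ij eqxx /polygauss hornerC mul1r.
  rewrite (_ : (fun x => _) = (fun x => 1 + polygauss (- 1%:P) x)).
    by apply: Ck_add; [exact: Ck_cst|exact: smooth_polygauss].
  by apply/funext => x; rewrite mxE (negbTE ij) /polygauss !hornerE mulN1r.
- by move=> x v w; rewrite !innerE; ring.
- move=> x v v0; rewrite innerE -!expr2.
  have Ex := warp_gt0 x.
  have w2 : 0 <= warp x * cdiff v ^+ 2 by rewrite mulr_ge0 ?sqr_ge0 ?ltW.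
  rewrite lt0r addr_ge0 ?sqr_ge0// andbT paddr_eq0 ?sqr_ge0//.
  rewrite sqrf_eq0 (mulf_eq0 (warp x)) (gt_eqF Ex)/= sqrf_eq0.
  apply: contra v0 => /andP[/eqP + /eqP]; rewrite /csum /cdiff => c0 w0.
  by apply/eqP/eq_rV2; rewrite mxE; lra.
Qed.

Lemma gwarp_continuous i j : continuous (fun x => gwarp x i j).
Proof. by have [/(_ i j 0%N)] := riemannian_metric_gwarp. Qed.

Lemma rnorm_ge_csum x v : `|csum v| <= rnorm gwarp x v.
Proof.
rewrite -sqrtr_sqr ler_wsqrtr// innerE -!expr2 lerDl.
by rewrite mulr_ge0 ?warp_ge0 ?sqr_ge0.
Qed.

Lemma warp_le1 x : warp x <= 1.
Proof. by rewrite /warp expR_le1 oppr_le0 sqr_ge0. Qed.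

Lemma rnorm_le_form x v : rnorm gwarp x v <= `|csum v| + `|cdiff v|.
Proof.
rewrite /rnorm innerE -!expr2; move: (csum v) (cdiff v) => c w.
rewrite -[leRHS]ger0_norm ?addr_ge0// -sqrtr_sqr ler_wsqrtr//.
have Ew : warp x * w ^+ 2 <= w ^+ 2 by rewrite ler_piMl ?sqr_ge0 ?warp_le1.
have cw := mulr_ge0 (normr_ge0 c) (normr_ge0 w).
by rewrite sqrrD !real_normK ?num_real//; lra.
Qed.

(** Where [|c| <= K] the metric controls [dw], through
    [1 <= exp (K^2) * exp (- c^2 / 2)]. *)
Lemma rnorm_cdiff x v K : `|csum x| <= K ->
  `|cdiff v| <= expR (K ^+ 2) * rnorm gwarp x v.
Proof.
move=> xK.
have eK : 0 <= expR (K ^+ 2) by exact: expR_ge0.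
rewrite /rnorm innerE -!expr2.
rewrite -[expR _]ger0_norm// -2!sqrtr_sqr -sqrtrM ?sqr_ge0//.
apply: ler_wsqrtr; rewrite mulrDr.
apply: (@le_trans _ _ (expR (K ^+ 2) ^+ 2 * (warp x * cdiff v ^+ 2))); last first.
  by rewrite lerDr mulr_ge0 ?sqr_ge0.
rewrite mulrA ler_peMl ?sqr_ge0// /warp expr2 -!expRD -expR0 ler_expR.
have : csum x ^+ 2 <= K ^+ 2.
  by rewrite -real_normK ?num_real// lerXn2r ?nnegrE// (le_trans _ xK).
have := sqr_ge0 K; lra.
Qed.

Lemma rnorm_csum0 x v : csum v = 0 ->
  rnorm gwarp x v = Num.sqrt (warp x) * `|cdiff v|.
Proof.
move=> c0; rewrite /rnorm innerE c0 mul0r add0r -expr2 sqrtrM ?warp_ge0//.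
by rewrite sqrtr_sqr.
Qed.

(** Vectors with [|dw v| = |dc v|], in particular those on the coordinate axes,
    have norm between [|dc v|] and [2 |dc v|] at every point; hence the factor
    [2] when the base point is changed. *)
Lemma rnorm_scale x y v a : `|cdiff v| = `|csum v| ->
  rnorm gwarp y (a *: v) <= 2 * `|a| * rnorm gwarp x v.
Proof.
move=> vv; apply: (le_trans (rnorm_le_form _ _)).
rewrite csumZ cdiffZ !normrM vv.
rewrite -mulrDr (mulrC 2) -mulrA ler_wpM2l// mulr2n mulrDl mul1r.
by rewrite lerD ?rnorm_ge_csum.
Qed.

End WarpedMetric.

(** * Distance estimates and completeness *)

Section Distance.
Context (R : realType).
Local Notation V := 'rV[R]_2.
Local Notation dist := (riemannian_dist (@gwarp R)).
Local Notation cgwarp := (@gwarp_continuous R).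

(** The metric is dominated by a flat one, so convergence of [c] and [w] implies
    convergence for the Riemannian distance. *)
Lemma dist_le_form x y : dist x y <= `|csum (y - x)| + `|cdiff (y - x)|.
Proof. by apply: (dist_le_segment cgwarp) => t _; exact: rnorm_le_form. Qed.

Lemma csum_le_dist x y : `|csum y - csum x| <= dist x y.
Proof.
apply: lb_le_inf; first exact: curve_lengths_nonempty.
move=> _ [c [pc c0 c1 ->]].
have := @curve_bound R 2 _ cgwarp c (@csum R) 1 pc ler01 _ 1.
rewrite c0 c1 mul1r; apply; last by rewrite ler01 lexx.
by move=> t v _; rewrite mul1r; exact: rnorm_ge_csum.
Qed.

(** A curve of length less than [1] that starts where [|c| <= M] stays in the
    strip [|c| <= M + 1], on which the warping factor is bounded below. *)
Lemma cdiff_le_dist x y M r : `|csum x| <= M -> r <= 1 -> dist x y < r ->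
  `|cdiff y - cdiff x| <= expR ((M + 1) ^+ 2) * r.
Proof.
move=> xM r1 xyr.
have [|_ [c [pc c0 c1 ->]] lr] := inf_lt _ xyr.
  exact: curve_lengths_nonempty.
have cM t : 0 <= t <= 1 -> `|csum (c t)| <= M + 1.
  move=> t01.
  have := @curve_bound R 2 _ cgwarp c (@csum R) 1 pc ler01 _ t t01.
  rewrite c0 mul1r => /(_ _)/= h.
  rewrite -(subrK (csum x) (csum (c t))) addrC.
  apply: (le_trans (ler_normD _ _)); apply: lerD => //.
  apply: le_trans (le_trans (ltW lr) r1); apply: h.
  by move=> s v _; rewrite mul1r; exact: rnorm_ge_csum.
have e0 : 0 <= expR ((M + 1) ^+ 2) :> R by exact: expR_ge0.
have := @curve_bound R 2 _ cgwarp c (@cdiff R) _ pc e0 _ 1.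
rewrite c0 c1 => h.
apply: (@le_trans _ _ (expR ((M + 1) ^+ 2) * curve_length (@gwarp R) c)).
  apply: h; last by rewrite ler01 lexx.
  by move=> t v t01; apply: rnorm_cdiff; exact: cM.
by rewrite ler_wpM2l// ltW.
Qed.

Lemma real_cauchy_cvg (v : nat -> R) :
  (forall eps : R, 0 < eps -> exists N, forall m n, (N <= m)%N -> (N <= n)%N ->
     `|v m - v n| <= eps) ->
  exists l : R, forall eps : R, 0 < eps -> exists N, forall n, (N <= n)%N ->
     `|l - v n| < eps.
Proof.
move=> vc; have : cvg (v @ \oo).
  apply/cauchy_cvgP/cauchy_exP => e e0.
  have [N vN] := vc (e / 2) (divr_gt0 e0 (ltr0Sn _ 1)).
  exists (v N); exists N => //= n Nn.
  rewrite /ball/= (le_lt_trans (vN N n _ _))//.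
  by rewrite ltr_pdivrMr// ltr_pMr// ltr1n.
move=> /cvg_ex[l vl]; exists l => e e0.
have [N _ vN] := (cvgrPdist_lt _ _).1 vl e e0.
by exists N => n; exact: vN.
Qed.

Lemma complete_gwarp : complete_dist dist.
Proof.
move=> u uc.
have [l1 l1P] : exists l : R, forall eps : R, 0 < eps ->
    exists N, forall n, (N <= n)%N -> `|l - csum (u n)| < eps.
  apply: (@real_cauchy_cvg (fun n => csum (u n))) => e e0.
  have [N uN] := uc e e0; exists N => m n Nm Nn.
  exact: le_trans (csum_le_dist _ _) (ltW (uN n m Nn Nm)).
have [l2 l2P] : exists l : R, forall eps : R, 0 < eps ->
    exists N, forall n, (N <= n)%N -> `|l - cdiff (u n)| < eps.
  apply: (@real_cauchy_cvg (fun n => cdiff (u n))) => e e0.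
  have [N1 uN1] := uc 1 ltr01.
  (* the terms from index [N1] on lie in the strip [|c| <= M] *)
  pose M := `|csum (u N1)| + 1.
  pose r := Num.min 1 (e / expR ((M + 1) ^+ 2)).
  have r0 : 0 < r by rewrite lt_min ltr01 divr_gt0// expR_gt0.
  have [N2 uN2] := uc r r0.
  exists (maxn N1 N2) => m n; rewrite !geq_max => /andP[m1 m2] /andP[n1 n2].
  have nM : `|csum (u n)| <= M.
    have := le_trans (csum_le_dist _ _) (ltW (uN1 N1 n (leqnn _) n1)).
    have := ler_normD (csum (u n) - csum (u N1)) (csum (u N1)).
    by rewrite subrK /M; lra.
  have r1 : r <= 1 by rewrite ge_min lexx.
  apply: (le_trans (cdiff_le_dist nM r1 (uN2 n m n2 m2))).
  have : r <= e / expR ((M + 1) ^+ 2) by rewrite ge_min lexx orbT.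
  by rewrite ler_pdivlMr ?expR_gt0// mulrC.
exists (point2 ((l1 + l2) / 2) ((l1 - l2) / 2)) => e e0.
have e20 : 0 < e / 2 by rewrite divr_gt0.
have [N1 N1P] := l1P _ e20; have [N2 N2P] := l2P _ e20.
exists (maxn N1 N2) => n; rewrite geq_max => /andP[/N1P h1 /N2P h2].
apply: (le_lt_trans (dist_le_form _ _)).
rewrite csumB cdiffB csum_point2 cdiff_point2.
have -> : (l1 + l2) / 2 + (l1 - l2) / 2 = l1 by field.
have -> : (l1 + l2) / 2 - (l1 - l2) / 2 = l2 by field.
lra.
Qed.

End Distance.

(** * The linear map is Anosov *)

Section Anosov.
Context (R : realType).
Local Notation V := 'rV[R]_2.

Lemma bij_inv_can (T : pointedType) (f h : T -> T) :
  cancel f h -> cancel h f -> bij_inv f = h.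
Proof.
move=> fK hK; apply/funext => y; rewrite -{1}[y]hK /bij_inv pinvKV//.
  by move=> a b _ _; exact: (can_inj fK).
by rewrite inE.
Qed.

Definition opB (p : V) : V := point2 (2 * p 0 0) (p 0 1 / 2).

Lemma opAK : cancel (@opA R) opB.
Proof. by move=> y; apply: eq_rV2; rewrite !mxE/=; field. Qed.

Lemma opBK : cancel opB (@opA R).
Proof. by move=> y; apply: eq_rV2; rewrite !mxE/=; field. Qed.

Lemma bij_inv_opA : bij_inv (@opA R) = opB.
Proof. exact: bij_inv_can opAK opBK. Qed.

Fact opA_linear : linear (@opA R).
Proof. by move=> a x y; apply: eq_rV2; rewrite !mxE/=; field. Qed.
HB.instance Definition _ :=
  GRing.isLinear.Build R V V *:%R (@opA R) opA_linear.

Fact opB_linear : linear opB.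
Proof. by move=> a x y; apply: eq_rV2; rewrite !mxE/=; field. Qed.
HB.instance Definition _ :=
  GRing.isLinear.Build R V V *:%R opB opB_linear.

Lemma iter_eigen n (f : {linear 'rV[R]_n -> 'rV[R]_n}) (a : R) e k v :
  f e = a *: e -> v \in <[e]>%VS -> iter k f v = a ^+ k *: v.
Proof.
move=> fe /vlineP[b ->]; elim: k => [|k IH] /=; first by rewrite scale1r.
by rewrite IH !linearZ/= fe !scalerA; congr (_ *: _); rewrite exprS; ring.
Qed.

(** On a line of eigenvectors with [|dw| = |dc|] the iterates are scalar, and
    [rnorm_scale] compares the norms at the two base points. *)
Lemma restr_norm_eigen (f : {linear V -> V}) (a : R) e x y k : 0 <= a ->
  `|cdiff e| = `|csum e| -> f e = a *: e ->
  (restr_norm (@gwarp R) x y <[e]>%VS ('d (iter k f) x) <= (2 * a ^+ k)%:E)%E.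
Proof.
move=> a0 ee fe; apply: ge_ereal_sup => _ [v [ve v1] <-]; rewrite lee_fin.
rewrite diff_iter (iter_eigen k fe ve).
have vv : `|cdiff v| = `|csum v|.
  have /vlineP[b ->] := ve.
  by rewrite csumZ cdiffZ !normrM ee.
apply: (le_trans (rnorm_scale x y _ vv)).
by rewrite ger0_norm ?exprn_ge0// ler_piMr// mulr_ge0 ?exprn_ge0.
Qed.

Lemma continuous_subbundle_line n (e : 'rV[R]_n) : e != 0 ->
  continuous_subbundle (fun _ : 'rV[R]_n => <[e]>%VS).
Proof.
move=> e0 x; exists 1%N, (fun _ _ => e).
apply: (@filterE _ _ (nbhs_filter x)) => y; split.
  have -> : [seq e | i <- enum 'I_1] = [:: e] by rewrite enum_ordSl enum_ord0.
  exact: seq1_basis.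
by move=> i; exact: (@cst_continuous 'rV[R]_n 'rV[R]_n e y).
Qed.

Lemma invariant_line n (f : {linear 'rV[R]_n -> 'rV[R]_n}) (a : R) e : a != 0 ->
  f e = a *: e -> invariant_subbundle f (fun _ => <[e]>%VS).
Proof.
move=> a0 fe x; rewrite limg_line lfunE/= diff_lin; last first.
  exact: linear_rV_continuous.
rewrite fe; apply/eqP; rewrite eqEsubv; apply/andP; split; rewrite -memvE.
  by apply/vlineP; exists a.
by apply/vlineP; exists a^-1; rewrite scalerA mulVf// scale1r.
Qed.

Definition e1 : V := point2 1 0.
Definition e2 : V := point2 0 1.

Lemma e12_decomp (v : V) : v = v 0 0 *: e1 + v 0 1 *: e2.
Proof. by apply: eq_rV2; rewrite !mxE/=; ring. Qed.

Lemma splitting_e12 : splitting (fun _ => <[e1]>%VS) (fun _ => <[e2]>%VS).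
Proof.
move=> x; split; apply/eqP.
  rewrite eqEsubv subvf/=; apply/subvP => v _; rewrite [v]e12_decomp.
  by apply: memv_add; apply/vlineP; eexists.
rewrite -subv0; apply/subvP => v /memv_capP[/vlineP[a ->] /vlineP[b]].
move=> /rowP /(_ 0); rewrite !mxE/= mulr1 mulr0 => ->.
by rewrite scale0r mem0v.
Qed.

Lemma anosov_opA : anosov (@gwarp R) (@opA R).
Proof.
have e10 : e1 != 0.
  by apply/eqP => /rowP/(_ 0)/eqP; rewrite !mxE/= oner_eq0.
have e20 : e2 != 0.
  by apply/eqP => /rowP/(_ 1)/eqP; rewrite !mxE/= oner_eq0.
have h0 : 0 <= 2^-1 :> R by rewrite invr_ge0.
have A1 : opA e1 = 2^-1 *: e1 by apply: eq_rV2; rewrite !mxE/=; field.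
have A2 : opA e2 = 2 *: e2 by apply: eq_rV2; rewrite !mxE/=; ring.
have B2 : opB e2 = 2^-1 *: e2 by apply: eq_rV2; rewrite !mxE/=; field.
have c1 : `|cdiff e1| = `|csum e1| by rewrite /cdiff /csum !mxE/= subr0 addr0.
have c2 : `|cdiff e2| = `|csum e2|.
  by rewrite /cdiff /csum !mxE/= !add0r normrN.
split.
  split; first by exists opB; [exact: opAK|exact: opBK].
    exact: (@Ck_linear _ 1 _ _ (@opA R) (@linear_rV_continuous _ _ _ _)).
  rewrite bij_inv_opA.
  exact: (@Ck_linear _ 1 _ _ opB (@linear_rV_continuous _ _ _ _)).
exists (fun _ => <[e1]>%VS), (fun _ => <[e2]>%VS), 2, 2^-1; split.
- by split; [exact: continuous_subbundle_line|exact: continuous_subbundle_line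
            |exact: splitting_e12].
- split; first by apply: invariant_line A1; rewrite invr_eq0.
  exact: invariant_line A2.
- by rewrite ltr0n invr_gt0 ltr0n invf_lt1// ltr1n.
- by move=> x k; exact: restr_norm_eigen.
- by move=> x k; rewrite bij_inv_opA; exact: restr_norm_eigen.
Qed.

End Anosov.

(** * Failure of shadowing *)

Section NoShadowing.
Context (R : realType).
Local Notation V := 'rV[R]_2.
Local Notation dist := (riemannian_dist (@gwarp R)).

Lemma pow2_bounded (z M : R) : 0 <= z ->
  (forall k : nat, 2 ^+ k * z <= M) -> z = 0.
Proof.
move=> z0 zM; apply/eqP; apply: contraT => zN0.
have zp : 0 < z by rewrite lt0r zN0.
have [k Mk] : exists k : nat, M / z < k%:R.
  by exists (Num.truncn (M / z)).+1; exact: truncnS_gt.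
have k2 : k%:R <= 2 ^+ k :> R by rewrite -natrX ler_nat ltnW// ltn_expl.
have := zM k; rewrite leNgt -ltr_pdivrMr// => /negP[].
exact: lt_le_trans k2.
Qed.

Lemma iter_opA k (y : V) :
  iter k (@opA R) y = point2 (y 0 0 / 2 ^+ k) (2 ^+ k * y 0 1).
Proof.
elim: k => [|k IH] /=.
  by apply: eq_rV2; rewrite !mxE/= expr0 ?divr1 ?mul1r.
rewrite IH; apply/rowP => j; rewrite !mxE/= exprS.
by case: (j == 0); field; rewrite ?expf_neq0.
Qed.

Lemma iter_opB k (y : V) :
  iter k (@opB R) y = point2 (2 ^+ k * y 0 0) (y 0 1 / 2 ^+ k).
Proof.
elim: k => [|k IH] /=.
  by apply: eq_rV2; rewrite !mxE/= expr0 ?divr1 ?mul1r.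
rewrite IH; apply/rowP => j; rewrite !mxE/= exprS.
by case: (j == 0); field; rewrite ?expf_neq0.
Qed.

(** For [y = (s, u)], [c (A^n y)] is [2^-n s + 2^n u]: boundedness for [n >= 0]
    forces [u = 0], and boundedness for [n <= 0] forces [s = 0]. *)
Lemma bounded_orbit0 (y : V) M :
  (forall n : int, `|csum (iterz (@opA R) n y)| <= M) -> y = 0.
Proof.
move=> yM.
have pk k : 0 < 2 ^+ k :> R by rewrite exprn_gt0.
have p1 k : (2 ^+ k)^-1 <= 1 :> R by rewrite invf_le1// exprn_ege1// ler1n.
have small (z : R) k : `|z / 2 ^+ k| <= `|z|.
  by rewrite normrM normfV (gtr0_norm (pk k)) ler_piMr.
have y1 : `|y 0 1| = 0.
  apply: (@pow2_bounded _ (M + `|y 0 0|)) => // k.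
  have := yM k%:Z; rewrite /iterz/= iter_opA csum_point2 => h.
  rewrite -(gtr0_norm (pk k)) -normrM.
  have := ler_normB (y 0 0 / 2 ^+ k + 2 ^+ k * y 0 1) (y 0 0 / 2 ^+ k).
  have -> : y 0 0 / 2 ^+ k + 2 ^+ k * y 0 1 - y 0 0 / 2 ^+ k = 2 ^+ k * y 0 1.
    by ring.
  by have := small (y 0 0) k; lra.
have y0 : `|y 0 0| = 0.
  apply: (@pow2_bounded _ (M + `|y 0 1|)) => // -[|k].
    have := yM 0; rewrite /iterz/= /csum => h.
    have := ler_normB (y 0 0 + y 0 1) (y 0 1).
    by rewrite addrK expr0 mul1r; lra.
  have := yM (Negz k); rewrite /iterz bij_inv_opA iter_opB csum_point2 => h.
  rewrite -(gtr0_norm (pk k.+1)) -normrM.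
  have := ler_normB (2 ^+ k.+1 * y 0 0 + y 0 1 / 2 ^+ k.+1) (y 0 1 / 2 ^+ k.+1).
  by rewrite addrK; have := small (y 0 1) k.+1; lra.
by apply: eq_rV2; rewrite mxE; exact: normr0_eq0.
Qed.

Lemma not_shadowing : ~ shadowing dist (@opA R).
Proof.
move=> /(_ 1 ltr01)[d d0 dP].
(* large enough for [2t exp (- 9t^2/2) <= 4/(9t)] to be at most [d] *)
pose t : R := 1 + d^-1.
have t1 : 1 <= t by rewrite lerDl invr_ge0 ltW.
have td : 1 <= t * d by rewrite mulrDl mul1r mulVf ?gt_eqF// lerDr ltW.
pose q : V := point2 (2 * t) t.
have [y yq] : exists y : V, forall n : int, dist (iterz (@opA R) n y) q <= 1.
  apply: (dP (fun _ => q)) => n.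
  have cq : csum (q - opA q) = 0.
    by rewrite csumB !csum_point2 !mxE/=; field.
  apply: (dist_le_segment (@gwarp_continuous R)) => s _; rewrite rnorm_csum0//.
  have -> : cdiff (q - opA q) = 2 * t.
    by rewrite cdiffB /cdiff !mxE/=; field.
  have -> : warp (segment (opA q) q s) = expR (- (9 / 2 * t ^+ 2)) ^+ 2.
    rewrite /warp /segment csumD /scale_vec csumZ cq mulr0 addr0.
    by rewrite /csum !mxE/= -expRM_natl; congr expR; field.
  rewrite sqrtr_sqr ger0_norm ?expR_ge0// ger0_norm; last lra.
  rewrite expRN mulrC ler_pdivrMr ?expR_gt0//.
  have := expR_ge1Dx (9 / 2 * t ^+ 2); move: (expR _) => e et.
  have : d * (1 + 9 / 2 * t ^+ 2) <= d * e by rewrite ler_pM2l.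
  have : t <= d * t ^+ 2 by rewrite expr2 mulrA (mulrC d) ler_peMl//; lra.
  lra.
have c3 : csum q = 3 * t by rewrite csum_point2; ring.
have y0 : y = 0.
  apply: (@bounded_orbit0 y (3 * t + 1)) => n.
  have := le_trans (csum_le_dist _ _) (yq n).
  have := ler_normB (csum q) (csum q - csum (iterz (@opA R) n y)).
  rewrite opprB addrC subrK c3 (@ger0_norm _ (3 * t)); lra.
have := le_trans (csum_le_dist _ _) (yq 0).
rewrite /iterz/= y0 /(csum 0) !mxE addr0 subr0 c3 ger0_norm; lra.
Qed.

End NoShadowing.

Theorem theorem2 (R : realType) :
  exists g : 'rV[R]_2 -> 'M[R]_2,
    [/\ riemannian_metric g,
        complete_dist (riemannian_dist g),
        anosov g (@opA R) &
        ~ shadowing (riemannian_dist g) (@opA R)].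
Proof.
exists (@gwarp R); split.
- exact: riemannian_metric_gwarp.
- exact: complete_gwarp.
- exact: anosov_opA.
- exact: not_shadowing.
Qed.
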